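(* Let $G$ be a group, let $H\leq G$ be a finite subgroup and let $Q_\bullet$ be a chain complex of finitely generated projective $\mathbb{C}[G]$-modules. Assume that every non-trivial element $h\in H$ has a centralizer $C_G(h)$ of infinite index in $G$. Then $$m_p^{(2)}(\chi, Q_\bullet) = \frac{\chi(1)}{|H|}\, b^{(2)}_p(Q_\bullet)$$ for every $\chi\in\operatorname{Irr}(H)$ and every $p\in\mathbb{Z}$.
   Context: Groups are discrete and modules are right modules. **Characters and bimodules.** A character of $G$ is a bounded function $\phi\colon G\to\mathbb{C}$ which is constant on conjugacy classes, satisfies $\phi(1)=1$, and is of positive type, i.e. $(\phi(g_i^{-1}g_j))_{i,j}$ is positive semi-definite for all $g_1,\dots,g_n\in G$. A tracial Hilbert $G$-bimodule is a Hilbert space $\mathcal{H}$ with a homomorphism $\ell\colon G\to U(\mathcal{H})$, an antihomomorphism $r\colon G\to U(\mathcal{H})$ and a vector $e\in\mathcal{H}$ with $\|e\|=1$, such that $\ell(g)r(h)=r(h)\ell(g)$ and $\ell(g)e=r(g)e$ for all $g,h\in G$, and the vectors $\ell(g)e$ span a dense subspace. Its character is $g\mapsto\langle \ell(g)e,e\rangle$. Every character $\phi$ arises from a tracial Hilbert $G$-bimodule, unique up to isomorphism, denoted $\mathcal{H}_\phi$. Let $\mathcal{N}_\phi=r(G)'$ be the commutant of the right action on $\mathcal{H}_\phi$, with trace $\tau(a)=\langle ae,e\rangle$. A finitely generated Hilbert $\mathcal{N}_\phi$-module is a Hilbert space $V$ with a unitary right $G$-action admitting a right $G$-equivariant isometric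 embedding into some $\mathcal{H}_\phi^n$; if the orthogonal projection onto the image of $V$ is given by the matrix $(a_{ij})\in M_n(\mathcal{N}_\phi)$, then $\dim_{\mathcal{N}_\phi}(V)=\sum_i\tau(a_{ii})$ (independent of the embedding). **Betti numbers.** If $Q$ is a finitely generated projective $\mathbb{C}[G]$-module, $Q\otimes_{\mathbb{C}[G]}\mathcal{H}_\phi$ is a finitely generated Hilbert $\mathcal{N}_\phi$-module (a closed subspace of $\mathcal{H}_\phi^n$ if $Q\oplus Q'\cong\mathbb{C}[G]^n$). For a homomorphism $f\colon Q_1\to Q_2$ of such modules put $f_\phi=f\otimes\mathrm{id}_{\mathcal{H}_\phi}$, $\operatorname{null}_\phi(f)=\dim_{\mathcal{N}_\phi}\ker f_\phi$, $\operatorname{rk}_\phi(f)=\dim_{\mathcal{N}_\phi}\overline{\operatorname{im} f_\phi}$. For a chain complex $(Q_\bullet,\partial)$ of finitely generated projective $\mathbb{C}[G]$-modules, $b_p^\phi(Q_\bullet)=\operatorname{null}_\phi(\partial_p)-\operatorname{rk}_\phi(\partial_{p+1})$. The $L^2$-Betti number is $b_p^{(2)}(Q_\bullet)=b_p^{\delta^{(2)}}(Q_\bullet)$, where $\delta^{(2)}=\delta_G^{(2)}$ is the regular character: $\delta^{(2)}(1)=1$, $\delta^{(2)}(g)=0$ for $g\neq1$. **$L^2$-multiplicities.** $\operatorname{Irr}(H)$ is the set of ordinary irreducible complex characters $\chi$ of $H$; $\widetilde\chi=\chi/\chi(1)$. Define $i_G\colon G\times H\to\mathbb{C}$ by $i_G(g,h)=[G:C_G(h)]^{-1}$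 if $g,h$ are conjugate in $G$ and $0$ otherwise ($[G:C_G(h)]^{-1}=0$ if the index is infinite). For a character $\phi$ of $H$, $\operatorname{ind}_H^G(\phi)(g)=\sum_{h\in H}i_G(g,h)\phi(h)$, which is a character of $G$. Then $m_p^{(2)}(\chi,Q_\bullet)=\frac{\chi(1)}{|H|}\,b_p^{\phi}(Q_\bullet)$ with $\phi=\operatorname{ind}_H^G(\widetilde\chi)$. *)

(* Defs.v *)
From HB Require Import structures.
From mathcomp Require Import all_boot all_order all_fingroup all_algebra.
From mathcomp Require Import mxrepresentation.
From mathcomp Require Import sesquilinear generic_quotient ring_quotient.
From mathcomp Require Import finmap complex.
From mathcomp Require Import monalg.
From mathcomp Require Import all_classical all_reals topology normedtype.

Set Implicit Arguments.
Unset Strict Implicit.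
Unset Printing Implicit Defensive.

Import Order.TTheory GRing.Theory Num.Theory.
Import numFieldNormedType.Exports.

Local Open Scope classical_set_scope.
Local Open Scope ring_scope.

#[short(type="subFinGroupType")]
HB.structure Definition SubFinGroup (G : groupType) (S : pred G) :=
  {H of SubGroup G S H & FinGroup H}.

(** * Group algebras *)

(* [monalg] puts a ring structure on [{malg K[G]}] only when the monoid [G] has
   no non-trivial units, so the ring structure is set up here for groups. *)
Section GroupAlgebra.
Variables (K : nzRingType) (G : groupType).

Definition group_algebra : Type := {malg K[G]}.
HB.instance Definition _ := GRing.Lmodule.on group_algebra.

Implicit Types (a b c : group_algebra) (g h : G).

Definition ga_one : group_algebra := << 1%g >>.

Definition ga_mul a b : group_algebra :=
  \sum_(g <- msupp a) \sum_(h <- msupp b) << a@_g * b@_h *g (g * h)%g >>.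

Lemma ga_mulE (d1 d2 : {fset G}) a b :
    (msupp a `<=` d1)%fset -> (msupp b `<=` d2)%fset ->
  ga_mul a b =
    \sum_(g <- d1) \sum_(h <- d2) << a@_g * b@_h *g (g * h)%g >>.
Proof.
move=> le1 le2; rewrite /ga_mul (big_fset_incl _ le1) /=.
  apply/eq_bigr => g _; apply/big_fset_incl => // h _ /mcoeff_outdom ->.
  by rewrite mulr0 monalgU0.
move=> g _ /mcoeff_outdom ag.
by rewrite big1 // => h _; rewrite ag mul0r monalgU0.
Qed.

Lemma ga_mulUU x y g h :
  ga_mul << x *g g >> << y *g h >> = << x * y *g (g * h)%g >>.
Proof.
by rewrite (ga_mulE msuppU_le msuppU_le) !big_seq_fset1 !mcoeffUU.
Qed.

Lemma ga_mulDl : left_distributive ga_mul +%R.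
Proof.
move=> a b c; have leU := fsubset_refl (msupp c).
rewrite (ga_mulE (msuppD_le a b) leU) (ga_mulE (fsubsetUl _ (msupp b)) leU).
rewrite (ga_mulE (fsubsetUr (msupp a) _) leU).
rewrite -big_split /=; apply/eq_bigr => g _.
rewrite -big_split /=; apply/eq_bigr => h _.
by rewrite mcoeffD mulrDl monalgUD.
Qed.

Lemma ga_mulDr : right_distributive ga_mul +%R.
Proof.
move=> c a b; have leU := fsubset_refl (msupp c).
rewrite (ga_mulE leU (msuppD_le a b)) (ga_mulE leU (fsubsetUl _ (msupp b))).
rewrite (ga_mulE leU (fsubsetUr (msupp a) _)).
rewrite -big_split /=; apply/eq_bigr => g _.
rewrite -big_split /=; apply/eq_bigr => h _.
by rewrite mcoeffD mulrDr monalgUD.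
Qed.

Lemma ga_mul0l : left_zero 0 ga_mul.
Proof. by move=> a; rewrite /ga_mul msupp0 big_seq_fset0. Qed.

Lemma ga_mul0r : right_zero 0 ga_mul.
Proof.
by move=> a; rewrite /ga_mul big1 // => g _; rewrite msupp0 big_seq_fset0.
Qed.

Lemma ga_mul_suml I (r : seq I) (F : I -> group_algebra) b :
  ga_mul (\sum_(i <- r) F i) b = \sum_(i <- r) ga_mul (F i) b.
Proof.
exact: (big_morph (ga_mul^~ b) (fun _ _ => ga_mulDl _ _ _) (ga_mul0l b)).
Qed.

Lemma ga_mul_sumr I (r : seq I) (F : I -> group_algebra) a :
  ga_mul a (\sum_(i <- r) F i) = \sum_(i <- r) ga_mul a (F i).
Proof.
exact: (big_morph (ga_mul a) (fun _ _ => ga_mulDr _ _ _) (ga_mul0r a)).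
Qed.

Lemma ga_mulA : associative ga_mul.
Proof.
move: ga_mul_suml ga_mul_sumr ga_mulUU; move: ga_mul => mul suml sumr mulUU.
move=> a b c; rewrite [a]monalgE !suml; apply: eq_bigr => g _.
rewrite [b]monalgE !suml !sumr suml; apply: eq_bigr => h _.
by rewrite [c]monalgE !sumr; apply: eq_bigr => k _; rewrite !mulUU mulrA mulgA.
Qed.

Lemma ga_mul1l : left_id ga_one ga_mul.
Proof.
move=> a; rewrite {1}[a]monalgE ga_mul_sumr [RHS]monalgE.
by apply/eq_bigr => g _; rewrite ga_mulUU mul1r mul1g.
Qed.

Lemma ga_mul1r : right_id ga_one ga_mul.
Proof.
move=> a; rewrite {1}[a]monalgE ga_mul_suml [RHS]monalgE.
by apply/eq_bigr => g _; rewrite ga_mulUU mulr1 mulg1.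
Qed.

Lemma ga_one_neq0 : ga_one != 0.
Proof. by rewrite monalgU_eq0 oner_eq0. Qed.

HB.instance Definition _ := GRing.Zmodule_isNzRing.Build group_algebra
  ga_mulA ga_mul1l ga_mul1r ga_mulDl ga_mulDr ga_one_neq0.

End GroupAlgebra.

(** * Tensor products over a non-commutative ring *)

(* A right [A]-module is a left module over the converse ring [A^c]:
   [a *: q : Q] is the element usually written [q a]. *)
Section Tensor.
Variables (A : nzRingType) (Q : lmodType A^c) (M : lmodType A).

Local Notation free := {malg int[(Q * M)%type]}.
Local Notation "q |> m" := (<< (q, m) >> : free) (at level 45).

Inductive tensor_rel : free -> Prop :=
| tensor_rel0 : tensor_rel 0
| tensor_relB x y : tensor_rel x -> tensor_rel y -> tensor_rel (x - y)
| tensor_relDl q q' m : tensor_rel ((q + q') |> m - q |> m - q' |> m)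
| tensor_relDr q m m' : tensor_rel (q |> (m + m') - q |> m - q |> m')
| tensor_relZ q (a : A) m : tensor_rel (((a : A^c) *: q) |> m - q |> (a *: m)).

Definition tensor_relb : {pred free} := fun x => `[< tensor_rel x >].

Lemma tensor_relb_zmod_closed : zmod_closed tensor_relb.
Proof.
split=> [|x y /asboolP rx /asboolP ry]; apply/asboolP.
  exact: tensor_rel0.
exact: tensor_relB.
Qed.

HB.instance Definition _ :=
  GRing.isZmodClosed.Build free tensor_relb tensor_relb_zmod_closed.

Definition tensor := Quotient.quot tensor_relb.
HB.instance Definition _ := GRing.Zmodule.on tensor.

Definition tens (q : Q) (m : M) : tensor := \pi_(tensor)%qT (q |> m).

Definition balanced (Z : zmodType) (b : Q -> M -> Z) :=
  [/\ forall q q' m, b (q + q') m = b q m + b q' m,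
      forall q m m', b q (m + m') = b q m + b q m'
    & forall q (a : A) m, b ((a : A^c) *: q) m = b q (a *: m)].

(* The additive map [q (x) m |-> b q m]; it is computed on a representative,
   which is harmless when [b] is balanced, see [tensor_lift_tens]. *)
Definition free_lift (Z : zmodType) (b : Q -> M -> Z) (x : free) : Z :=
  \sum_(k <- msupp x) b k.1 k.2 *~ x@_k.

Definition tensor_lift (Z : zmodType) (b : Q -> M -> Z) (t : tensor) : Z :=
  free_lift b (repr t).

Section Lift.
Variables (Z : zmodType) (b : Q -> M -> Z).

Lemma free_liftE (d : {fset (Q * M)%type}) (x : free) : (msupp x `<=` d)%fset ->
  free_lift b x = \sum_(k <- d) b k.1 k.2 *~ x@_k.
Proof.
move=> le; rewrite /free_lift (big_fset_incl _ le) //= => k _ /mcoeff_outdom ->.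
by rewrite mulr0z.
Qed.

Lemma free_liftB (x y : free) :
  free_lift b (x - y) = free_lift b x - free_lift b y.
Proof.
rewrite (free_liftE (msuppB_le x y)) (free_liftE (fsubsetUl _ (msupp y))).
rewrite (free_liftE (fsubsetUr (msupp x) _)) -sumrB; apply: eq_bigr => k _.
by rewrite mcoeffB mulrzBr.
Qed.

Lemma free_liftU q m : free_lift b (q |> m) = b q m.
Proof. by rewrite (free_liftE msuppU_le) big_seq_fset1 mcoeffUU. Qed.

Hypothesis bal : balanced b.

Lemma free_lift_rel x : tensor_rel x -> free_lift b x = 0.
Proof.
case: bal => bDl bDr bZ; elim=> {x} [|x y _ x0 _ y0|q q' m|q m m'|q a m].
- by rewrite /free_lift msupp0 big_seq_fset0.
- by rewrite free_liftB x0 y0 subrr.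
- by rewrite !free_liftB !free_liftU bDl addrAC addrK subrr.
- by rewrite !free_liftB !free_liftU bDr addrAC addrK subrr.
- by rewrite free_liftB !free_liftU bZ subrr.
Qed.

Lemma tensor_lift_pi x : tensor_lift b (\pi_(tensor)%qT x) = free_lift b x.
Proof.
apply/eqP; rewrite -subr_eq0 -free_liftB; apply/eqP/free_lift_rel.
have : (repr (\pi_(tensor)%qT x) - x) \in tensor_relb.
  by rewrite Quotient.idealrBE reprK.
by move/asboolP.
Qed.

Lemma tensor_lift_tens q m : tensor_lift b (tens q m) = b q m.
Proof. by rewrite tensor_lift_pi free_liftU. Qed.

Lemma tensor_liftB t u :
  tensor_lift b (t - u) = tensor_lift b t - tensor_lift b u.
Proof.
rewrite -[t]reprK -[u]reprK -[X in tensor_lift b X]raddfB.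
by rewrite !tensor_lift_pi free_liftB.
Qed.

End Lift.

Lemma tensor_pi0 x : tensor_rel x -> \pi_(tensor)%qT x = 0.
Proof.
move=> rx; rewrite -[RHS](raddf0 (\pi_(tensor)%qT)).
by apply/eqP; rewrite -Quotient.idealrBE subr0; apply/asboolP.
Qed.

Lemma tens_balanced : balanced tens.
Proof.
split=> [q q' m|q m m'|q a m]; apply/eqP; rewrite -subr_eq0 ?opprD ?addrA.
- by apply/eqP; rewrite -(tensor_pi0 (tensor_relDl q q' m)) !raddfB.
- by apply/eqP; rewrite -(tensor_pi0 (tensor_relDr q m m')) !raddfB.
- by apply/eqP; rewrite -(tensor_pi0 (tensor_relZ q a m)) raddfB.
Qed.

End Tensor.

(* The map [f (x) id]. *)
Definition tensor_map (A : nzRingType) (Q1 Q2 : lmodType A^c) (M : lmodType A)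
    (f : {linear Q1 -> Q2}) : tensor Q1 M -> tensor Q2 M :=
  tensor_lift (fun q m => tens (f q) m).

Lemma tensor_map_tens (A : nzRingType) (Q1 Q2 : lmodType A^c) (M : lmodType A)
    (f : {linear Q1 -> Q2}) (q : Q1) (m : M) :
  tensor_map f (tens q m) = tens (f q) m.
Proof.
have [tDl tDr tZ] := tens_balanced Q2 M.
apply: (tensor_lift_tens (b := fun q m => tens (f q) m)).
by split=> *; rewrite ?linearD ?linearZ ?tDl ?tDr ?tZ.
Qed.

(** * Finitely generated projective modules and chain complexes *)

Record fg_proj_presentation (A : nzRingType) (Q : lmodType A^c) := {
  pres_rank : nat;
  pres_compl : lmodType A^c;
  pres_iso : {linear (Q * pres_compl)%type -> 'rV[A^c]_pres_rank};
  pres_isoP : bijective pres_iso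
}.

Definition fg_projective (A : nzRingType) (Q : lmodType A^c) :=
  inhabited (fg_proj_presentation Q).

(* [Q (x)_A M -> (Q (+) Q') (x)_A M = A^n (x)_A M = M^n] *)
Definition pres_embed (A : nzRingType) (Q : lmodType A^c) (M : lmodType A)
    (P : fg_proj_presentation Q) : tensor Q M -> 'rV[M]_(pres_rank P) :=
  tensor_lift (fun q m => \row_j ((pres_iso P (q, 0) 0 j : A) *: m)).

Lemma pres_embed_tens (A : nzRingType) (Q : lmodType A^c) (M : lmodType A)
    (P : fg_proj_presentation Q) (q : Q) (m : M) :
  pres_embed P (tens q m) = \row_j ((pres_iso P (q, 0) 0 j : A) *: m).
Proof.
apply: (tensor_lift_tens (b := fun q m => \row_j _)).
split=> [{}q q' {}m|{}q {}m m'|{}q a {}m]; apply/rowP => j; rewrite !mxE.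
- have -> : (q + q', 0) = (q, 0) + (q', 0) :> (Q * pres_compl P)%type.
    by congr pair; rewrite addr0.
  by rewrite linearD mxE scalerDl.
- by rewrite scalerDr.
- have -> : ((a : A^c) *: q, 0) =
             (a : A^c) *: (q, 0) :> (Q * pres_compl P)%type.
    by congr pair; rewrite scaler0.
  by rewrite linearZ mxE scalerA.
Qed.

(* [differential p] is the differential of degree [p + 1]. *)
Record chain_complex (A : nzRingType) := {
  chain :> int -> lmodType A;
  differential : forall p : int, {linear chain (p + 1) -> chain p};
  differentialK : forall p x, differential p (differential (p + 1) x) = 0
}.

(** * Tracial Hilbert bimodules *)

HB.mixin Record NormedModule_isHilbert (R : realType) V
    of CompleteNormedModule R[i] V := {
  inner : {dot V for Num.conj};
  inner_normE : forall x : V, `|x| ^+ 2 = inner x x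
}.

#[short(type="hilbertType")]
HB.structure Definition Hilbert (R : realType) :=
  {V of CompleteNormedModule R[i] V & NormedModule_isHilbert R V}.

Definition unitary (R : realType) (V : hilbertType R) (u : V -> V) :=
  [/\ linear u, bijective u & forall x y, inner (u x) (u y) = inner x y].

Record tracial_bimodule (R : realType) (G : groupType) := {
  bimod :> hilbertType R;
  lact : G -> bimod -> bimod;
  ract : G -> bimod -> bimod;
  vac : bimod;
  lact_unitary : forall g, unitary (lact g);
  ract_unitary : forall g, unitary (ract g);
  lactM : forall g h x, lact (g * h)%g x = lact g (lact h x);
  ractM : forall g h x, ract (g * h)%g x = ract h (ract g x);
  lract_comm : forall g h x, lact g (ract h x) = ract h (lact g x);
  lract_vac : forall g, lact g vac = ract g vac;
  vac_norm : `|vac| = 1;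
  lact_vac_dense :
    dense [set \sum_(g <- msupp a) a@_g *: lact g vac |
             a in [set: {malg R[i][G]}]]
}.

Definition bimod_character (R : realType) (G : groupType)
    (B : tracial_bimodule R G) (g : G) : R[i] :=
  inner (lact g (vac B)) (vac B).

(* [B] as a left module over the group algebra, through the left action. *)
Section LeftModule.
Variables (R : realType) (G : groupType) (B : tracial_bimodule R G).

Definition bimod_left : Type := B.
HB.instance Definition _ := Topological.on bimod_left.
HB.instance Definition _ := GRing.Zmodule.on bimod_left.

Implicit Types (a b : group_algebra R[i] G) (x y : bimod_left).

Definition ga_scale a x : bimod_left :=
  \sum_(g <- msupp a) a@_g *: lact g (x : B).

Lemma lact_linear g : linear (@lact R G B g).
Proof. by case: (lact_unitary B g). Qed.

HB.instance Definition _ g :=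
  GRing.isLinear.Build R[i] B B *:%R (@lact R G B g) (lact_linear g).

Lemma lact1 x : lact 1%g (x : B) = x.
Proof.
have [_ /bij_inj inj1 _] := lact_unitary B 1%g.
by apply: inj1; rewrite -lactM mulg1.
Qed.

Lemma ga_scaleE (d : {fset G}) a x : (msupp a `<=` d)%fset ->
  ga_scale a x = \sum_(g <- d) a@_g *: lact g (x : B).
Proof.
move=> le; rewrite /ga_scale (big_fset_incl _ le) //= => g _ /mcoeff_outdom ->.
by rewrite scale0r.
Qed.

Lemma ga_scaleDl x a b : ga_scale (a + b) x = ga_scale a x + ga_scale b x.
Proof.
rewrite (ga_scaleE _ (msuppD_le a b)) (ga_scaleE _ (fsubsetUl _ (msupp b))).
rewrite (ga_scaleE _ (fsubsetUr (msupp a) _)) -big_split; apply: eq_bigr => g _.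
by rewrite mcoeffD scalerDl.
Qed.

Lemma ga_scaleDr a x y : ga_scale a (x + y) = ga_scale a x + ga_scale a y.
Proof.
by rewrite -big_split; apply: eq_bigr => g _; rewrite /= linearD scalerDr.
Qed.

Lemma ga_scaleU c g x : ga_scale << c *g g >> x = c *: lact g (x : B).
Proof. by rewrite (ga_scaleE _ msuppU_le) big_seq_fset1 mcoeffUU. Qed.

Lemma ga_scale0l x : ga_scale 0 x = 0.
Proof. by rewrite /ga_scale msupp0 big_seq_fset0. Qed.

Lemma ga_scale_suml I (r : seq I) (F : I -> group_algebra R[i] G) x :
  ga_scale (\sum_(i <- r) F i) x = \sum_(i <- r) ga_scale (F i) x.
Proof. exact: (big_morph (ga_scale^~ x) (ga_scaleDl x) (ga_scale0l x)). Qed.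

Lemma ga_scaleA a b x : ga_scale a (ga_scale b x) = ga_scale (a * b) x.
Proof.
rewrite -[a * b]/(ga_mul a b) /ga_mul ga_scale_suml; apply: eq_bigr => g _.
rewrite ga_scale_suml linear_sum scaler_sumr; apply: eq_bigr => h _.
by rewrite ga_scaleU linearZ scalerA lactM.
Qed.

Lemma ga_scale1 x : ga_scale 1 x = x.
Proof. by rewrite ga_scaleU scale1r lact1. Qed.

HB.instance Definition _ := GRing.Zmodule_isLmodule.Build
  (group_algebra R[i] G) bimod_left ga_scaleA ga_scale1 ga_scaleDr ga_scaleDl.

End LeftModule.

(** * Von Neumann dimension *)

Section Dimension.
Variables (R : realType) (G : groupType) (B : tracial_bimodule R G).

(* The commutant [r(G)'] in the bounded operators, and its trace. *)
Definition vN_algebra : set (B -> B) :=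
  [set a | [/\ linear a, continuous a
             & forall g x, a (ract g x) = ract g (a x)]].

Definition vN_trace (a : B -> B) : R[i] := inner (a (vac B)) (vac B).

Definition mx_op n (a : 'I_n -> 'I_n -> B -> B) (x : 'rV[B]_n) : 'rV[B]_n :=
  \row_i \sum_j a i j (x 0 j).

Definition inner_rV n (x y : 'rV[B]_n) : R[i] := \sum_i inner (x 0 i) (y 0 i).

Definition orthogonal_projection n (V : set 'rV[B]_n)
    (P : 'rV[B]_n -> 'rV[B]_n) :=
  forall x, V (P x) /\ forall v, V v -> inner_rV (x - P x) v = 0.

Definition has_vN_dim n (V : set 'rV[B]_n) (d : R[i]) :=
  exists a : 'I_n -> 'I_n -> B -> B,
    [/\ forall i j, vN_algebra (a i j),
        orthogonal_projection V (mx_op a)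
      & d = \sum_i vN_trace (a i i)].

End Dimension.

(** * Betti numbers *)

Section Betti.
Variables (R : realType) (G : groupType).

Local Notation CG := (group_algebra R[i] G).

Section Phi.
Variable phi : G -> R[i].

(* The dimensions below depend neither on the bimodule with character [phi]
   nor on the presentation of the projective module, so [xget] selects the
   only element of a singleton. The default value 0 is only reached when
   [phi] is not a character or the module is not finitely generated
   projective. *)
Definition phi_null (Q1 Q2 : lmodType CG^c) (f : {linear Q1 -> Q2}) : R[i] :=
  xget 0 [set d | exists (B : tracial_bimodule R G)
                          (P : fg_proj_presentation Q1),
    bimod_character B = phi /\
    has_vN_dim (B := B) (pres_embed (M := bimod_left B) P @`
      [set t | tensor_map (M := bimod_left B) f t = 0]) d].

Definition phi_rk (Q1 Q2 : lmodType CG^c) (f : {linear Q1 -> Q2}) : R[i] :=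
  xget 0 [set d | exists (B : tracial_bimodule R G)
                          (P : fg_proj_presentation Q2),
    bimod_character B = phi /\
    has_vN_dim (B := B) (closure (pres_embed (M := bimod_left B) P @`
      range (tensor_map (M := bimod_left B) f))) d].

(* [differential Q (p - 1)] is the differential leaving degree [p], as
   [p - 1 + 1 = p]. *)
Definition betti (Q : chain_complex CG^c) (p : int) : R[i] :=
  phi_null (differential Q (p - 1)) - phi_rk (differential Q p).

End Phi.

Definition regular_character (g : G) : R[i] := (g == 1%g)%:R.

Definition l2_betti := betti regular_character.

End Betti.

(** * Induced characters and multiplicities *)

Section Induction.
Variables (R : realType) (G : groupType).

Definition group_centralizer (h : G) : set G := [set x | commute x h].

Definition group_cosets (K : set G) : set (set G) :=
  [set [set (k * g)%g | k in K] | g in [set: G]].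

Definition infinite_index (K : set G) := infinite_set (group_cosets K).

Definition inv_index (K : set G) : R[i] :=
  if `[< infinite_index K >] then 0 else (#|` fset_set (group_cosets K)|%:R)^-1.

Definition iG (g h : G) : R[i] :=
  if `[< exists x, (h ^ x)%g = g >] then inv_index (group_centralizer h) else 0.

Variables (S : pred G) (H : subFinGroupType S).

Definition induced (phi : H -> R[i]) (g : G) : R[i] :=
  \sum_(h : H) iG g (val h) * phi h.

Definition irr_character (chi : H -> R[i]) :=
  exists n (rho : mx_representation R[i] [set: H]%G n),
    mx_irreducible rho /\ chi = fun h => \tr (rho h).

Definition normalized (chi : H -> R[i]) (h : H) : R[i] := chi h / chi 1%g.

Definition l2_multiplicity (chi : H -> R[i])
    (Q : chain_complex (group_algebra R[i] G)^c) (p : int) : R[i] :=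
  chi 1%g / #|{: H}|%:R * betti (induced (normalized chi)) Q p.

End Induction.

(* Main.v *)
Require Import Defs.
From HB Require Import structures.
From mathcomp Require Import all_boot all_order all_fingroup all_algebra.
From mathcomp Require Import mxrepresentation.
From mathcomp Require Import finmap complex.
From mathcomp Require Import all_classical all_reals.

Set Implicit Arguments.
Unset Strict Implicit.
Unset Printing Implicit Defensive.

(** Both sides carry the factor [chi 1 / #|H|], and the remaining factors are
   the same Betti number for two characters of [G]: the one induced by the
   normalization of [chi], and the regular character. So it suffices that these
   two characters agree ([induced_normalized_regular]).

   In the sum defining the induced character, the weight of [h] carries the
   factor [[G : C_G(h)]^-1], which vanishes for [h <> 1] because that
   centralizer has infinite index. Only [h = 1] is left: its centralizer is all
   of [G], of index 1, and its conjugacy class is [{1}], so its weight is the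
   indicator function of [1] ([iG1]). The coefficient of that weight is
   [chi 1 / chi 1], which is 1 because the degree of an irreducible
   representation is not zero ([irr_character1_neq0]). *)

Import GRing.Theory Num.Theory.

Local Open Scope ring_scope.

Section Index.
Variables (R : realType) (G : groupType).
Local Open Scope classical_set_scope.

Lemma group_cosets_setT : group_cosets [set: G] = [set [set: G]].
Proof.
apply/seteqP; split=> [_ [g _ <-]|_ ->].
  apply/seteqP; split=> // x _; exists (x * g^-1)%g => //.
  by rewrite mulgVK.
exists 1%g => //; apply/seteqP; split=> // x _.
by exists x => //; rewrite mulg1.
Qed.

Lemma inv_index_setT : inv_index R [set: G] = 1.
Proof.
rewrite /inv_index /infinite_index group_cosets_setT fset_set1 cardfs1 invr1.
by rewrite asboolF // => inf; apply: inf; exact: finite_set1.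
Qed.

(** An infinite index has inverse 0, so such an [h] drops out of induced
   characters even at the elements of [G] conjugate to it. *)
Lemma iG_infinite_index (g h : G) :
  infinite_index (group_centralizer h) -> iG R g h = 0.
Proof.
by move=> infh; rewrite /iG /inv_index (asboolT infh) if_same.
Qed.

Lemma iG1 (g : G) : iG R g 1%g = regular_character R g.
Proof.
have C1 : group_centralizer (1%g : G) = setT.
  by apply/seteqP; split=> // x _; exact: commute1.
rewrite /iG C1 inv_index_setT /regular_character; case: asboolP => [[x <-]|no].
  by rewrite conj1g eqxx.
case: eqP => // g1; case: no; exists 1%g.
by rewrite conj1g g1.
Qed.

End Index.

Section Induction.
Variables (R : realType) (G : groupType) (S : pred G) (H : subFinGroupType S).

(** [chi 1] is the degree as an element of the field [R[i]]; it is not zero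
   because irreducible modules are not zero and [R[i]] has characteristic 0. *)
Lemma irr_character1_neq0 (chi : H -> R[i]) :
  irr_character chi -> chi 1%g != 0.
Proof.
move=> [n [rho [[_ nz _] ->]]].
rewrite repr_mx1 mxtrace1 pnatr_eq0.
by apply: contraNneq nz => n0; rewrite -mxrank_eq0 mxrank1 n0.
Qed.

Lemma induced_normalized_regular (chi : H -> R[i]) :
    (forall h : H, h <> 1%g -> infinite_index (group_centralizer (val h))) ->
    chi 1%g != 0 ->
  induced (normalized chi) = regular_character R (G := G).
Proof.
move=> infC chi1; apply/funext => g; rewrite /induced (bigD1 1%g) //= big1.
  by rewrite addr0 /normalized divff // mulr1 gmulf1 iG1.
by move=> h /eqP h1; rewrite iG_infinite_index ?mul0r //; exact: infC.
Qed.

End Induction.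

Theorem proposition5p5 (R : realType) (G : groupType)
    (S : pred G) (H : subFinGroupType S)
    (Q : chain_complex (group_algebra R[i] G)^c)
    (projQ : forall p : int, fg_projective (Q p))
    (infC : forall h : H, h <> 1%g -> infinite_index (group_centralizer (val h)))
    (chi : H -> R[i]) (irr_chi : irr_character chi) (p : int) :
  l2_multiplicity chi Q p = chi 1%g / #|{: H}|%:R * l2_betti Q p.
Proof.
rewrite /l2_multiplicity /l2_betti (induced_normalized_regular infC) //.
exact: irr_character1_neq0.
Qed.
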